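(* Let $C$ be any orientation of a cycle of odd length $\ell\ge 3$. Then $C$ is not quasirandom-forcing; that is, there exists a tournamenton $W$ with $t(C,W)=2^{-\ell}$ that is not equal to $1/2$ almost everywhere.
   Context: A kernel is a bounded measurable function $[0,1]^2\to\mathbb{R}$. A tournamenton is a non-negative kernel $W$ with $W(x,y)+W(y,x)=1$ for all $(x,y)\in[0,1]^2$. For an oriented graph $H$ with vertex set $V(H)$ and edge set $E(H)$, and a kernel $U$, the homomorphism density is $t(H,U)=\int_{[0,1]^{V(H)}}\prod_{vw\in E(H)}U(x_v,x_w)\,\mathrm{d}x_{V(H)}$. Let $\|H\|$ denote the number of edges of $H$. An oriented graph $H$ is quasirandom-forcing if every tournamenton $W$ with $t(H,W)=2^{-\|H\|}$ satisfies $W=1/2$ almost everywhere. *)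

(* Defs.v *)
From HB Require Import structures.
From mathcomp Require Import all_boot all_order all_algebra.
From mathcomp Require Import all_classical all_reals all_analysis.

Set Implicit Arguments.
Unset Strict Implicit.
Unset Printing Implicit Defensive.

Import Order.TTheory GRing.Theory Num.Theory.
Import numFieldNormedType.Exports.

Local Open Scope classical_set_scope.
Local Open Scope ring_scope.

Section cons_measure.
Local Open Scope ereal_scope.
Context d (T : measurableType d) (R : realType) (n : nat).

Definition pair_cons (p : T * n.-tuple T) : n.+1.-tuple T :=
  [tuple of p.1 :: p.2].

Lemma measurable_pair_cons : measurable_fun [set: T * n.-tuple T] pair_cons.
Proof. exact: measurable_cons. Qed.

Variables (mu : {sigma_finite_measure set T -> \bar R})
  (nu : {sigma_finite_measure set (n.-tuple T) -> \bar R}).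

Definition cons_measure : set (n.+1.-tuple T) -> \bar R :=
  pushforward (mu \x nu) pair_cons.

Let mpre A : measurable A -> measurable (pair_cons @^-1` A).
Proof.
by move=> mA; rewrite -[X in measurable X]setTI; exact: measurable_pair_cons.
Qed.

Let cons_measure0 : cons_measure set0 = 0.
Proof. by rewrite /cons_measure /pushforward preimage_set0 measure0. Qed.

Let cons_measure_ge0 A : 0 <= cons_measure A.
Proof. exact: (measure_ge0 (mu \x nu)). Qed.

Let cons_measure_sigma_additive : semi_sigma_additive cons_measure.
Proof.
move=> F mF tF mUF; rewrite /cons_measure /pushforward preimage_bigcup.
apply: measure_semi_sigma_additive.
- by move=> k; exact: mpre.
- apply/trivIsetP => /= i j _ _ ij; rewrite -preimage_setI.
  by move/trivIsetP : tF => /(_ _ _ _ _ ij) ->//; rewrite preimage_set0.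
- by rewrite -preimage_bigcup; exact: mpre.
Qed.

HB.instance Definition _ := isMeasure.Build _ _ _ cons_measure
  cons_measure0 cons_measure_ge0 cons_measure_sigma_additive.

Let cons_measure_sigma_finite : sigma_finite setT cons_measure.
Proof.
have /sigma_finiteP[F [FT ndF Foo]] := sigma_finiteT mu.
have /sigma_finiteP[G [GT ndG Goo]] := sigma_finiteT nu.
pose FG k := F k `*` G k.
have FGT : \bigcup_k FG k = setT.
  apply/seteqP; split=> // -[x t] _.
  have [i _ Fix] : (\bigcup_i F i) x by rewrite -FT.
  have [j _ Gjt] : (\bigcup_j G j) t by rewrite -GT.
  exists (maxn i j) => //; split.
  - by move: x Fix {Gjt}; exact/subsetPset/ndF/leq_maxl.
  - by move: t Gjt; exact/subsetPset/ndG/leq_maxr.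
pose g (t : n.+1.-tuple T) : T * n.-tuple T := (thead t, [tuple of behead t]).
have mg : measurable_fun setT g.
  by apply: measurable_fun_pair; [exact: measurable_tnth|
                                  exact: measurable_behead].
have gK p : g (pair_cons p) = p.
  by case: p => x t; congr (_, _); apply: val_inj.
exists (fun k => g @^-1` FG k).
  by rewrite -preimage_bigcup FGT preimage_setT.
move=> k; have [mFk Fkoo] := Foo k; have [mGk Gkoo] := Goo k; split.
  by rewrite -[X in measurable X]setTI; apply: mg => //; exact: measurableX.
rewrite /cons_measure /pushforward -comp_preimage.
rewrite [X in (mu \x nu) X](_ : _ = FG k); last first.
  by apply/seteqP; split=> p; rewrite /preimage/= gK.
by rewrite /FG product_measure1E// lte_mul_pinfty// ge0_fin_numE.
Qed.

HB.instance Definition _ := Measure_isSigmaFinite.Build _ _ _ cons_measure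
  cons_measure_sigma_finite.

End cons_measure.

(* The [n]-fold product of [mu] on [n.-tuple T], with the product
   sigma-algebra. *)
Fixpoint tuple_measure d (T : measurableType d) (R : realType)
    (mu : {sigma_finite_measure set T -> \bar R}) (n : nat) :
    {sigma_finite_measure set (n.-tuple T) -> \bar R} :=
  match n with
  | 0 => \d_ [tuple]
  | n'.+1 => cons_measure mu (tuple_measure mu n')
  end.

Section kernels.
Context (R : realType).
Implicit Types W : R * R -> R.

Definition unit_square : set (R * R) := `[0, 1] `*` `[0, 1].

Definition unit_cube n : set (n.-tuple R) :=
  [set x | forall i, tnth x i \in `[0, 1]].

(* Only the values on [unit_square] are relevant: a kernel is a function on
   [0,1]^2, extended arbitrarily to R^2. *)
Definition is_kernel W :=
  measurable_fun unit_square W /\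
  exists M : R, forall p, unit_square p -> `|W p| <= M.

Definition is_tournamenton W :=
  [/\ is_kernel W,
      forall p, unit_square p -> 0 <= W p &
      forall x y, unit_square (x, y) -> W (x, y) + W (y, x) = 1].

Definition ae_half W :=
  {ae (lebesgue_measure \x lebesgue_measure)%E,
    forall p, unit_square p -> W p = 2^-1}.

End kernels.
Arguments unit_cube : clear implicits.

(* Asymmetry with [u = v] excludes loops. *)
Record oriented_graph (V : finType) := OrientedGraph {
  edge :> rel V;
  edge_asym : forall u v, edge u v -> ~~ edge v u }.

Definition edge_set V (H : oriented_graph V) : {set V * V} :=
  [set e | H e.1 e.2].

(* A point [x] of [0,1]^V is stored as a [#|V|]-tuple, along the enumeration
   of [V]: its coordinate at [v] is [tnth x (enum_rank v)]. *)
Definition hom_density (R : realType) V (H : oriented_graph V)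
    (U : R * R -> R) : R :=
  \int[tuple_measure lebesgue_measure #|V|]_(x in unit_cube R #|V|)
    \prod_(e in edge_set H) U (tnth x (enum_rank e.1), tnth x (enum_rank e.2)).

Definition quasirandom_forcing (R : realType) (V : finType)
    (H : oriented_graph V) :=
  forall W : R * R -> R, is_tournamenton W ->
    hom_density H W = 2 ^- #|edge_set H| -> ae_half W.

(* [ordS] is the successor modulo [l], so [cycle_adj] is adjacency in the
   cycle 0, 1, ..., l-1 (a simple graph on [l] vertices when [3 <= l]). *)
Definition cycle_adj l (i j : 'I_l) : bool := (j == ordS i) || (i == ordS j).

Definition cycle_orientation l (V : finType) (H : oriented_graph V) :=
  exists2 f : 'I_l -> V, bijective f &
    forall i j, H (f i) (f j) || H (f j) (f i) = cycle_adj i j.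

(* Main.v *)
Require Import Defs.
From HB Require Import structures.
From mathcomp Require Import all_boot all_order all_algebra.
From mathcomp Require Import all_classical all_reals all_analysis.
From mathcomp Require Import lra.

Set Implicit Arguments.
Unset Strict Implicit.
Unset Printing Implicit Defensive.

Import Order.TTheory GRing.Theory Num.Theory.
Import numFieldNormedType.Exports.

Local Open Scope classical_set_scope.
Local Open Scope ring_scope.

(* Write W = 1/2 + U with U antisymmetric and expand the product over the
   edges of C. If every vertical section of U has integral 0, then every term
   indexed by a nonempty proper set of edges vanishes, such a set having a
   vertex of degree 1. So it suffices to find such a U <> 0 together with a
   measure-preserving map that changes the sign of U: the term with all the
   edges is then multiplied by (-1)^l = -1. We take the blow-up of the cyclic
   triangle on Z/3, with the negation of Z/3. *)

(** Iterating [ordS] from any vertex goes round the whole cycle. *)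
Lemma ordS_closed_setT l (F : {set 'I_l}) i :
  i \in F -> (forall j, j \in F -> ordS j \in F) -> F = [set: 'I_l]%SET.
Proof.
move=> iF FS; have iterF k : iter k (@ordS l) i \in F.
  by elim: k => //= k; exact: FS.
have iterE k : iter k (@ordS l) i = ((i + k) %% l)%N :> nat.
  elim: k => [|k IHk] /=; first by rewrite addn0 modn_small.
  by rewrite IHk -addn1 modnDml addn1 addnS.
apply/setP => j; rewrite inE.
(* Starting from [i], these steps lead to [l + j], which is [j] modulo [l]; adding [l] avoids a
   truncated subtraction when [j < i]. *)
rewrite (_ : j = iter (l - i + j) (@ordS l) i) ?iterF//.
apply: val_inj; rewrite /= iterE addnA subnKC ?modnDl ?modn_small//.
exact: ltnW.
Qed.

(** * Sums over the colourings of a cycle by a finite abelian group *)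

Section cycle_sum.
Context (R : numFieldType) (A : finZmodType) (u : A -> R).
Hypotheses (u_odd : forall a, u (- a) = - u a) (u_sum0 : \sum_a u a = 0).
Context (l : nat) (sg : 'I_l -> R).

(** The weight of the edge between [i] and [ordS i]. The factor [sg i] is meant to be 1 or -1
    according to its direction, so that one cyclic formula serves all orientations. *)
Let U (s : {ffun 'I_l -> A}) i := sg i * u (s (ordS i) - s i).

(** Negating all colours permutes the colourings and changes the sign of each of the [l] factors, so
    the sum is its own opposite. *)
Lemma sum_odd_cycle0 : odd l ->
  \sum_(s : {ffun 'I_l -> A}) \prod_i U s i = 0.
Proof.
move=> l_odd; pose opp (s : {ffun 'I_l -> A}) := [ffun i => - s i].
have oppK : involutive opp by move=> s; apply/ffunP => i; rewrite !ffunE opprK.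
apply/eqP; rewrite -eqNr; apply/eqP; rewrite -sumrN.
rewrite [RHS](reindex_inj (inv_inj oppK)).
apply: eq_bigr => s _; rewrite [RHS](eq_bigr (fun i => - U s i)) => [|i _].
  by rewrite prodrN card_ord -signr_odd l_odd mulN1r.
by rewrite /U !ffunE -opprD u_odd mulrN.
Qed.

(* The edge [i] of [F] is the only one meeting the vertex [ordS i], so summing
   over the value of [s] there already gives [0]. *)
Lemma sum_pendant_edge0 (F : {set 'I_l}) i : i \in F -> ordS i \notin F ->
  \sum_(s : {ffun 'I_l -> A}) \prod_(j in F) U s j = 0.
Proof.
move=> iF SiF; have iSi : i != ordS i by apply: contraNneq SiF => <-.
pose shift a (s : {ffun 'I_l -> A}) :=
  [ffun j => if j == ordS i then s j + a else s j].
have shiftK a : cancel (shift a) (shift (- a)).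
  move=> s; apply/ffunP => j; rewrite !ffunE.
  by case: eqP => // _; rewrite addrK.
have U_shift a s j : j \in F -> j != i -> U (shift a s) j = U s j.
  move=> jF ji; rewrite /U !ffunE (inj_eq (@ordS_inj l)) (negPf ji).
  by rewrite ifN //; apply: contraNneq SiF => <-.
have A_neq0 : #|A|%:R != 0 :> R.
  by rewrite pnatr_eq0 -lt0n; apply/card_gt0P; exists 0.
(* Summing over one coordinate is done by averaging: the sum is repeated for each shift [a] of the
   colour at [ordS i], and the sum over [a] is taken first. *)
apply: (mulfI A_neq0); rewrite mulr0 mulr_natl -sumr_const.
under eq_bigr => a _ do rewrite (reindex_inj (can_inj (shiftK a))).
rewrite exchange_big big1 //= => s _.
under eq_bigr => a _.
  rewrite (bigD1 i iF) /= (eq_bigr (U s)) => [|j /andP[jF ji]]; last first.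
    exact: U_shift.
  rewrite /U !ffunE eqxx (negPf iSi) (addrAC _ a) (addrC _ a).
over.
rewrite -mulr_suml -mulr_sumr.
have := u_sum0; rewrite (reindex_inj (addIr (s (ordS i) - s i))) => ->.
by rewrite mulr0 mul0r.
Qed.

(** In the expansion over sets [F] of edges, only the empty one contributes: any other [F] either
    has an edge [i] with [ordS i] outside [F], or is closed under [ordS] and hence the whole
    cycle. *)
Lemma sum_cycle_shift (c : R) : odd l ->
  \sum_(s : {ffun 'I_l -> A}) \prod_i (c + sg i * u (s (ordS i) - s i)) =
  (#|A|%:R * c) ^+ l.
Proof.
move=> l_odd.
under eq_bigr => s _ do under eq_bigr => i _ do rewrite addrC.
under eq_bigr => s _ do rewrite bigA_distr /=.
rewrite exchange_big /= (bigD1 finset.set0) //=.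
rewrite [X in _ + X]big1 ?addr0 => [|F F0].
  under eq_bigr => s _ do under eq_bigr => i _ do rewrite inE.
  rewrite sumr_const prodr_const card_ord card_ffun card_ord.
  by rewrite -[LHS]mulr_natl natrX exprMn.
under eq_bigr => s _ do rewrite big_if /= [X in _ * X]prodr_const.
rewrite -mulr_suml; apply/eqP; rewrite mulf_eq0; apply/orP; left; apply/eqP.
have [/existsP[i /andP[iF SiF]]|] :=
  boolP [exists i, (i \in F) && (ordS i \notin F)].
  exact: sum_pendant_edge0 iF SiF.
rewrite negb_exists => /forallP FS; have [i iF] := finset.set0Pn _ F0.
rewrite (ordS_closed_setT iF) => [|j jF].
  under eq_bigr => s _ do under eq_bigl => j do rewrite inE.
  exact: sum_odd_cycle0.
by have := FS j; rewrite jF negbK.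
Qed.

End cycle_sum.

(** * Indexing the edges of an oriented cycle by its positions *)

Section cycle_reindexing.
Context (V : finType) (l : nat) (C : oriented_graph V) (f : 'I_l -> V).
Hypotheses (l_ge3 : (3 <= l)%N) (f_bij : bijective f)
  (f_adj : forall i j, C (f i) (f j) || C (f j) (f i) = cycle_adj i j).

Let f_inj : injective f := bij_inj f_bij.

Definition cycle_arc i : V * V :=
  if C (f i) (f (ordS i)) then (f i, f (ordS i)) else (f (ordS i), f i).

(** Here [3 <= l] matters: on two vertices, both positions would give the same edge. *)
Lemma ordSS_neq (i : 'I_l) : ordS (ordS i) != i.
Proof.
apply/eqP => /(congr1 val) /= /eqP.
rewrite -addn1 modnDml addn1 -[X in _ == X](modn_small (ltn_ord i)) -addn2.
by rewrite -[X in _ == X %[mod _]]addn0 eqn_modDl mod0n modn_small.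
Qed.

Lemma cycle_arc_inj : injective cycle_arc.
Proof.
have no_swap i j : f i = f (ordS j) -> f (ordS i) = f j -> i = j.
  by move=> /f_inj -> /f_inj /eqP; rewrite (negPf (ordSS_neq j)).
move=> i j; rewrite /cycle_arc; case: ifP => _; case: ifP => _ [].
- by move=> /f_inj.
- exact: no_swap.
- by move=> SiEj iESj; exact: no_swap.
- by move=> _ /f_inj.
Qed.

Lemma edge_set_cycle : edge_set C = [set cycle_arc i | i in 'I_l]%SET.
Proof.
have arcC i : C (cycle_arc i).1 (cycle_arc i).2.
  have := f_adj i (ordS i); rewrite /cycle_adj eqxx /cycle_arc.
  by case: ifP.
have [g fK gK] := f_bij.
apply/setP => -[v w]; rewrite inE /=; apply/idP/imsetP => [Cvw|[i _ vw]].
  have := f_adj (g v) (g w); rewrite !gK Cvw => /esym/orP[/eqP|/eqP] gE.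
    by exists (g v) => //; rewrite /cycle_arc -gE !gK Cvw.
  (* Here [v] follows [w] on the cycle; by asymmetry the edge from [w] to [v] is absent, so
     [cycle_arc] takes its second branch. *)
  exists (g w) => //; rewrite /cycle_arc -gE !gK.
  by rewrite (negPf (edge_asym Cvw)).
by have := arcC i; rewrite -vw.
Qed.

Lemma card_edge_set_cycle : #|edge_set C| = l.
Proof.
by rewrite edge_set_cycle card_imset ?card_ord//; exact: cycle_arc_inj.
Qed.

(** Tuples along the enumeration of [V] are relabelled through [f] as colourings of the cycle. An
    edge directed against [ordS] has the opposite colour difference, which [sg] absorbs because [u]
    is odd. *)
Lemma sum_cycle_density (R : numFieldType) (A : finZmodType) (u : A -> R) c :
    (forall a, u (- a) = - u a) -> \sum_a u a = 0 -> odd l ->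
  \sum_(t : #|V|.-tuple A) \prod_(e in edge_set C)
     (c + u (tnth t (enum_rank e.2) - tnth t (enum_rank e.1))) =
  (#|A|%:R * c) ^+ l.
Proof.
move=> u_odd u_sum0 l_odd.
pose sg i : R := if C (f i) (f (ordS i)) then 1 else -1.
rewrite -(@sum_cycle_shift R A u u_odd u_sum0 l sg c l_odd).
have [g fK gK] := f_bij.
pose h (s : {ffun 'I_l -> A}) := [tuple s (g (enum_val i)) | i < #|V|].
pose h' (t : #|V|.-tuple A) := [ffun i => tnth t (enum_rank (f i))].
rewrite (reindex h) /=; last first.
  exists h' => x _.
    by apply/ffunP => i; rewrite ffunE tnth_mktuple enum_rankK fK.
  by apply/eq_from_tnth => i; rewrite tnth_mktuple ffunE gK enum_valK.
apply: eq_bigr => s _; rewrite edge_set_cycle big_imset/=; last first.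
  by move=> i j _ _; exact: cycle_arc_inj.
apply: eq_bigr => i _; rewrite !tnth_mktuple !enum_rankK /cycle_arc /sg.
by case: ifP => _ /=; rewrite !fK ?mul1r// mulN1r -u_odd opprB.
Qed.

End cycle_reindexing.

(** * Boxes and their product measure *)

Lemma measurable_box d (T : measurableType d) n (A : 'I_n -> set T) :
    (forall i, measurable (A i)) ->
  measurable [set x : n.-tuple T | forall i, A i (tnth x i)].
Proof.
move=> mA; rewrite (_ : [set _ | _] =
    \bigcap_(i in [set: 'I_n]) ((fun x : n.-tuple T => tnth x i) @^-1` A i)).
  apply: fin_bigcap_measurable => // i _.
  by rewrite -[X in measurable X]setTI; exact: measurable_tnth.
by apply/seteqP; split=> x H i; [move=> _; exact: (H i)|exact: (H i I)].
Qed.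

(** By induction on [n]: the preimage of a box under [pair_cons] is its first side times the box of
    the other sides. *)
Lemma tuple_measure_box d (T : measurableType d) (R : realType)
    (mu : {sigma_finite_measure set T -> \bar R}) n (A : 'I_n -> set T) :
    (forall i, measurable (A i)) ->
  tuple_measure mu n [set x | forall i, A i (tnth x i)] =
  (\prod_(i < n) mu (A i))%E.
Proof.
elim: n A => [|n IHn] A mA.
  rewrite big_ord0 /= diracE mem_set//; by case.
rewrite big_ord_recl /= /cons_measure /pushforward.
pose B := [set x : n.-tuple T | forall i, A (lift ord0 i) (tnth x i)].
rewrite (_ : _ @^-1` _ = A ord0 `*` B).
  rewrite product_measure1E//; last first.
    exact: (@measurable_box _ _ _ (A \o lift ord0) (fun i => mA _)).
  by congr *%E; exact: (IHn (A \o lift ord0) (fun i => mA _)).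
apply/seteqP; split=> -[x t] /=.
  move=> xtA; have {}xtA i : A i (tnth (pair_cons (x, t)) i) := xtA i.
  split=> [|i]; first exact: (xtA ord0).
  by have := xtA (lift ord0 i); rewrite tnthS.
move=> [Ax Bt] i; case: (unliftP ord0 i) => [j ->|-> //].
by rewrite tnthS; exact: Bt.
Qed.

(** * Step functions on the thirds of the unit interval *)

Section step.
Context {R : realType}.

(** The values lie in ['I_3] for its group structure Z/3, in which colours are subtracted. *)
Definition third (x : R) : 'I_3 :=
  if x < 3^-1 then 0 else if x < 2 / 3 then 1 else 2.

Definition piece k : set R := [set` `[0, 1]] `&` third @^-1` [set k].

Lemma piece_itv k : exists2 i : interval R,
  piece k = [set` i] & lebesgue_measure [set` i] = (3^-1)%:E.
Proof.
have : k \in [:: 0; 1; 2] by case: k => -[|[|[|]]].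
rewrite !inE => /or3P[]/eqP ->;
  [exists `[0, 3^-1[ | exists `[3^-1, 2 / 3[ | exists `[2 / 3, 1]].
all: try by rewrite lebesgue_measure_itv /= lte_fin ifT -?EFinB;
  [congr EFin|]; lra.
all: apply/seteqP; split=> x; rewrite /piece /third /= !in_itv /=.
all: case: (ltP x 3^-1) => ?; case: (ltP x (2 / 3)) => ? //.
all: try by move=> [].
all: try by move=> /andP[? ?]; split => //;
  lazymatch goal with |- is_true _ => lra | _ => exfalso; lra end.
all: try by move=> [/andP[? ?] /(congr1 val)]; first [done|lra].
Qed.

Lemma measurable_piece k : measurable (piece k).
Proof. by have [i -> _] := piece_itv k. Qed.

Lemma lebesgue_measure_piece k : lebesgue_measure (piece k) = (3^-1)%:E.
Proof. by have [i -> ->] := piece_itv k. Qed.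

(** As [t] varies, these boxes partition the unit cube. *)
Definition cell n (t : n.-tuple 'I_3) : set (n.-tuple R) :=
  [set x | forall i, piece (tnth t i) (tnth x i)].

Lemma measurable_cell n (t : n.-tuple 'I_3) : measurable (cell t).
Proof.
exact: (@measurable_box _ _ _ (piece \o tnth t) (fun i => measurable_piece _)).
Qed.

Lemma tuple_measure_cell n (t : n.-tuple 'I_3) :
  tuple_measure lebesgue_measure n (cell t) = (3 ^- n)%:E.
Proof.
rewrite [LHS](@tuple_measure_box _ _ _ lebesgue_measure n (piece \o tnth t)).
  rewrite (eq_bigr (fun=> (3^-1)%:E)) => [|i _]; last first.
    exact: lebesgue_measure_piece.
  by rewrite prodEFin prodr_const card_ord exprVn.
by move=> i; exact: measurable_piece.
Qed.

Lemma cell_cube n (t : n.-tuple 'I_3) : cell t `<=` unit_cube R n.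
Proof. by move=> x xt i; have [] := xt i. Qed.

Lemma cell_indic n (t : n.-tuple 'I_3) x : unit_cube R n x ->
  \1_(cell t) x = (t == map_tuple third x)%:R :> R.
Proof.
move=> x01; rewrite indicE; congr (_%:R); apply: congr1.
apply/idP/eqP => [/set_mem xt|->].
  by apply/eq_from_tnth => i; rewrite tnth_map; have [_ <-] := xt i.
by apply/mem_set => i; rewrite tnth_map; split=> //=; exact: x01.
Qed.

Lemma measurable_cube n : measurable (unit_cube R n).
Proof.
exact: (@measurable_box _ _ n (fun=> [set` `[0 : R, 1]])
  (fun=> measurable_itv _)).
Qed.

Lemma tuple_measure_cube n :
  tuple_measure lebesgue_measure n (unit_cube R n) = 1%E.
Proof.
rewrite [LHS](@tuple_measure_box _ _ _ lebesgue_measure n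
  (fun=> [set` `[0 : R, 1]]))//.
rewrite big1 // => i _; rewrite [LHS]lebesgue_measure_itv /= lte_fin ltr01.
by rewrite -EFinB subr0.
Qed.

(** On the cube the integrand is a combination of the indicators of the cells, each of measure
    [3 ^- n]. *)
Lemma Rintegral_step n (F : n.-tuple 'I_3 -> R) :
  \int[tuple_measure lebesgue_measure n]_(x in unit_cube R n)
    F (map_tuple third x) = (\sum_t F t) / 3 ^+ n.
Proof.
set mu := tuple_measure _ _.
have icell t : mu.-integrable (unit_cube R n) (EFin \o \1_(cell t)).
  apply: measurable_bounded_integrable.
  - exact: measurable_cube.
  - by rewrite [X in (X < _)%E]tuple_measure_cube ltry.
  - by apply: measurable_realfun.measurable_indic; exact: measurable_cell.
  - exists 1; split=> // M M1 x _ /=; apply: le_trans (ltW M1).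
    by rewrite indicE; case: (_ \in _); rewrite ?normr1 ?normr0.
rewrite (@eq_Rintegral _ _ _ mu _
  (fun x => \sum_t F t * \1_(cell t) x)); last first.
  move=> x /set_mem x01; rewrite (bigD1 (map_tuple third x)) //= big1.
    by rewrite addr0 cell_indic// eqxx mulr1.
  by move=> t; rewrite cell_indic// => /negPf ->; rewrite mulr0.
rewrite /Rintegral.
under eq_integral => x _ do rewrite -sumEFin.
rewrite integral_sum; last 2 first.
- exact: measurable_cube.
- move=> t; under eq_fun => x do rewrite EFinM.
  by apply: integrableZl (icell t); exact: measurable_cube.
under eq_bigr => t _.
  under eq_integral => x _ do rewrite EFinM.
  rewrite integralZl//; [|exact: measurable_cube|exact: icell].
  rewrite integral_indic; [|exact: measurable_cube|exact: measurable_cell].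
  rewrite setIidl; [|exact: cell_cube].
  rewrite [X in (_ * X)%E]tuple_measure_cell.
over.
by rewrite sumEFin /= mulr_suml.
Qed.

(** On the unit square the function is a finite combination of indicators of the rectangles
    [piece i] times [piece j]. *)
Lemma measurable_step (g : 'I_3 -> 'I_3 -> R) :
  measurable_fun (@unit_square R) (fun p => g (third p.1) (third p.2)).
Proof.
apply: (eq_measurable_fun
  (fun p => \sum_i \sum_j g i j * \1_(piece i `*` piece j) p)).
  move=> p /set_mem[p1 p2].
  have pE i j : \1_(piece i `*` piece j) p =
      ((i == third p.1) && (j == third p.2))%:R :> R.
    rewrite indicE; congr (_%:R); apply: congr1.
    apply/idP/andP => [/set_mem[[_ <-] [_ <-]] //|[/eqP-> /eqP->]].
    exact/mem_set.
  rewrite (bigD1 (third p.1))//= (bigD1 (third p.2))//= pE !eqxx mulr1.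
  rewrite !big1 ?addr0 // => i /negPf ip.
    by rewrite big1 // => j _; rewrite pE ip mulr0.
  by rewrite pE ip andbF mulr0.
apply: measurable_sum => i; apply: measurable_sum => j.
apply: measurable_realfun.measurable_funM; first exact: measurable_cst.
apply: measurable_realfun.measurable_indic.
by apply: measurableX; exact: measurable_piece.
Qed.

End step.

(** * The blow-up of the cyclic triangle *)

Definition third_diff (R : realType) (a : 'I_3) : R :=
  if a == 1 then 2^-1 else if a == 2 then - 2^-1 else 0.

Lemma ord3_cases (a : 'I_3) : [\/ a = 0, a = 1 | a = 2].
Proof.
by case: a => -[|[|[|]]] // ?;
  [constructor 1|constructor 2|constructor 3]; exact: val_inj.
Qed.

Lemma third_diffN (R : realType) a : third_diff R (- a) = - third_diff R a.
Proof. by case: (ord3_cases a) => ->; rewrite /third_diff /= ?oppr0 ?opprK. Qed.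

Lemma sum_third_diff (R : realType) : \sum_a third_diff R a = 0.
Proof. by rewrite !big_ord_recl big_ord0 /third_diff /=; lra. Qed.

Lemma third_diff_bound (R : realType) a : - 2^-1 <= third_diff R a <= 2^-1.
Proof. by rewrite /third_diff; case: ifP => _; [|case: ifP => _]; lra. Qed.

(** The value is 1/2 inside a third, 1 from a third to the cyclically next one, and 0 in the reverse
    direction. *)
Definition cyclic_tournamenton (R : realType) (p : R * R) : R :=
  2^-1 + third_diff R (third p.2 - third p.1).

Lemma cyclic_tournamenton_is_tournamenton (R : realType) :
  is_tournamenton (@cyclic_tournamenton R).
Proof.
have W01 (p : R * R) : 0 <= cyclic_tournamenton p <= 1.
  have := third_diff_bound R (third p.2 - third p.1).
  by rewrite /cyclic_tournamenton; lra.
split=> [|p _|x y _]; last 2 first.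
- by have /andP[] := W01 p.
- rewrite /cyclic_tournamenton /= -(opprB (third y)) third_diffN; lra.
split; first exact: (measurable_step (fun i j => 2^-1 + third_diff R (j - i))).
by exists 1 => p _; have /andP[W0 W1] := W01 p; rewrite ger0_norm.
Qed.

Lemma cyclic_tournamenton_not_half (R : realType) :
  ~ ae_half (@cyclic_tournamenton R).
Proof.
(* On this rectangle of measure 1/9 the tournamenton is 1. *)
move=> W_half; pose B : set (R * R) := piece 0 `*` piece 1.
have mB : measurable B by apply: measurableX; exact: measurable_piece.
have : (lebesgue_measure \x lebesgue_measure)%E.-negligible B.
  apply: negligibleS W_half => -[x y] [[x01 x0] [y01 y1]] /=.
  move=> /(_ (conj x01 y01)).
  rewrite /cyclic_tournamenton /= x0 y1 /third_diff /=; lra.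
apply/negligibleP => //.
rewrite /B [LHS]product_measure1E; try exact: measurable_piece.
rewrite [X in (X * _)%E]lebesgue_measure_piece.
rewrite [X in (_ * X)%E]lebesgue_measure_piece.
by rewrite -EFinM => -[]; lra.
Qed.

Lemma cyclic_tournamenton_density (R : realType) l (V : finType)
    (C : oriented_graph V) : odd l -> (3 <= l)%N -> cycle_orientation l C ->
  hom_density C (@cyclic_tournamenton R) = 2 ^- l.
Proof.
move=> l_odd l_ge3 [f f_bij f_adj].
have cardV : #|V| = l by rewrite -(bij_eq_card f_bij) card_ord.
pose F (t : #|V|.-tuple 'I_3) := \prod_(e in edge_set C)
  (2^-1 + third_diff R (tnth t (enum_rank e.2) - tnth t (enum_rank e.1))).
rewrite /hom_density.
transitivity (\int[tuple_measure lebesgue_measure #|V|]_(x in unit_cube R #|V|)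
    F (map_tuple third x)).
  apply: eq_Rintegral => x _; apply: eq_bigr => e _.
  by rewrite !tnth_map.
rewrite Rintegral_step (sum_cycle_density l_ge3 f_bij f_adj) //.
(* The sum over colourings is [(3 / 2) ^ l], divided by [3 ^ l] since [V] has [l] vertices. *)
- by rewrite cardV card_ord exprMn exprVn mulrAC divff ?mul1r// expf_neq0.
- exact: third_diffN.
- exact: sum_third_diff.
Qed.

Theorem theorem13 (R : realType) (l : nat) (V : finType)
    (C : oriented_graph V) :
  odd l -> (3 <= l)%N -> cycle_orientation l C ->
  ~ quasirandom_forcing R C /\
  exists W : R * R -> R,
    [/\ is_tournamenton W, hom_density C W = 2 ^- l & ~ ae_half W].
Proof.
move=> l_odd l_ge3 C_cycle.
have WT := cyclic_tournamenton_is_tournamenton R.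
have Wt := cyclic_tournamenton_density R l_odd l_ge3 C_cycle.
have Wn := @cyclic_tournamenton_not_half R.
split; last by exists (@cyclic_tournamenton R).
case: C_cycle => f f_bij f_adj forcing; apply: Wn; apply: forcing => //.
by rewrite (card_edge_set_cycle l_ge3 f_bij f_adj).
Qed.
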